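(* Let $m\ge 2$ and $z\ge 1$ be integers. Algorithm SE-C runs in time $\mathcal{O}(nmz+nm^2)$ to create a graph of $n$ vertices.
   Context: **Random systematic sampling (RSS).** Input: elements $x_1,\dots,x_N$ with integer frequencies $d_1,\dots,d_N$, $s=\sum_i d_i$, and a sample size $m$ dividing $s$. Shuffle the elements (together with their frequencies), draw $r$ uniformly from $[0,s/m)$, set $psum=0$, and scan $i=1,\dots,N$: add $d_i$ to $psum$, and if $psum>r$, output $x_i$ and increase $r$ by $s/m$. **Random systematic partitioning (RSP).** Input: elements $x_1,\dots,x_N$ with frequencies $d_1,\dots,d_N$ and integers $s,m$ with $\sum_i d_i=sm$ and maximum frequency at most $s$ (frequencies not known in advance can be created in one pass). Start with empty sets $H_1,\dots,H_s$ and $k=1$; shuffle the elements; for each element in the shuffled order, as many times as its frequency, add it to $H_k$ and set $k\leftarrow(k\bmod s)+1$. Output $H_1,\dots,H_s$. **Algorithm SE-C.** The state is a graph $\mathcal{G}(V,E)$ and a list $H$ of hyperedges (repetitions allowed), each hyperedge being a set of vertices. Start with a connected graph $\mathcal{G}_0(V_0,E_0)$ such that $m$ divides $2|E_0|$ and no vertex has degree higher than $2|E_0|/m$, and initialize $H$ as a list of $2|E_0|/m$ hyperedges, each consisting of exactly $m$ distinct vertices, such that each vertex lies in exactly as many hyperedges as its degree in $\mathcal{G}_0$. While $|V|<n$ (where $n$ is the desired number of vertices), perform a round: (1) select $z$ hyperedges from $H$ uniformly at random with replacement; (2) apply RSS with sample size $m$ to the union of the vertices of these hyperedges, each vertex with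 frequency equal to the number of selected hyperedges (with multiplicity) containing it, to obtain $u=(u_1,\dots,u_m)$; (3) add a new vertex $v$ to $V$ and the edges $(v,u_1),\dots,(v,u_m)$ to $E$; (4) update $H$: select (without replacement) and remove $m-2$ hyperedges $h_1,\dots,h_{m-2}$ from $H$; form the bag $A$ consisting of the $m(m-2)$ elements of $h_1,\dots,h_{m-2}$, $m$ copies of $v$, and all elements of $u$; perform RSP on $A$ with $s=m$, and add the resulting $m$ sets to $H$.
   Formalization: Completion is claimed only if the initial list has at least max(1, m−2) hyperedges, else a round cannot be carried out; the bound including the construction of the initial hyperedges assumes |E_0| ≤ nm, while the rounds alone are bounded for every seed. *)

(* Defs.v *)
From Stdlib Require Import String.
From mathcomp Require Import all_boot.

Set Implicit Arguments.
Unset Strict Implicit.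
Unset Printing Implicit Defensive.

(** * A randomized unit-cost RAM

    Memory consists of registers and arrays named by strings and holding
    natural numbers; the initial contents of a cell that is not part of the
    input is arbitrary.  A program is a closed term that depends on none of the
    parameters of the problem, and its running time counts one unit for every
    command executed and every node of every expression evaluated. *)

Inductive op := OAdd | OSub | OMul | ODiv | OMod | OLt | OEq | OAnd.

Inductive loc := Reg of string | Cell of string & exp
with exp := Num of nat | Fetch of loc | Bin of op & exp & exp.

Inductive cmd :=
| Skip
| Assign of loc & exp
| Draw of loc & exp
| Seq of cmd & cmd
| If of exp & cmd & cmd
| While of exp & cmd.

Record state := State {
  regs : string -> nat;
  arrs : string -> nat -> nat;
  draws : nat  (* number of random draws made so far *)
}.

(** Comparisons return 0 or 1; subtraction is truncated. *)
Definition eval_op (o : op) (a b : nat) : nat :=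
  match o with
  | OAdd => a + b | OSub => a - b | OMul => a * b
  | ODiv => a %/ b | OMod => a %% b
  | OLt => a < b | OEq => a == b
  | OAnd => (a != 0) && (b != 0)
  end.

Fixpoint eval (st : state) (e : exp) : nat :=
  match e with
  | Num k => k
  | Fetch (Reg x) => regs st x
  | Fetch (Cell a i) => arrs st a (eval st i)
  | Bin o e1 e2 => eval_op o (eval st e1) (eval st e2)
  end.

Definition store (st : state) (l : loc) (k : nat) : state :=
  match l with
  | Reg x =>
      State (fun y => if String.eqb y x then k else regs st y)
            (arrs st) (draws st)
  | Cell a i =>
      let j := eval st i in
      State (regs st)
            (fun b h => if String.eqb b a && (h == j) then k else arrs st b h)
            (draws st)
  end.

Definition count_draw (st : state) : state :=
  State (regs st) (arrs st) (draws st).+1.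

Fixpoint ecost (e : exp) : nat :=
  match e with
  | Num _ => 1
  | Fetch (Reg _) => 1
  | Fetch (Cell _ i) => (ecost i).+1
  | Bin _ e1 e2 => (ecost e1 + ecost e2).+1
  end.

Definition lcost (l : loc) : nat := ecost (Fetch l).

(** A tape fixes the outcome of all random draws: [w j k] is the value in
    {0, ..., k} returned by the j-th draw when this draw is uniform on
    {0, ..., k}.  Executions are deterministic given the tape; a property that
    holds for every tape holds for every outcome of the independent uniform
    draws. *)
Definition tape := nat -> forall k : nat, 'I_k.+1.

(** [exec w c st t o]: started in [st], the command [c] stops after time [t].
    The outcome [o] is the final state, or [None] if the run was aborted by an
    attempt to draw from the empty set. *)
Inductive exec (w : tape) : cmd -> state -> nat -> option state -> Prop :=
| ExecSkip st :
    exec w Skip st 1 (Some st)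
| ExecAssign l e st :
    exec w (Assign l e) st (lcost l + ecost e).+1
         (Some (store st l (eval st e)))
| ExecDraw l e st k :
    eval st e = k.+1 ->
    exec w (Draw l e) st (lcost l + ecost e).+1
         (Some (count_draw (store st l (w (draws st) k))))
| ExecDrawEmpty l e st :
    eval st e = 0 ->
    exec w (Draw l e) st (lcost l + ecost e).+1 None
| ExecSeq c1 c2 st st' t1 t2 o :
    exec w c1 st t1 (Some st') -> exec w c2 st' t2 o ->
    exec w (Seq c1 c2) st (t1 + t2).+1 o
| ExecSeqAbort c1 c2 st t1 :
    exec w c1 st t1 None ->
    exec w (Seq c1 c2) st t1.+1 None
| ExecIf e c1 c2 st t o :
    exec w (if eval st e != 0 then c1 else c2) st t o ->
    exec w (If e c1 c2) st (ecost e + t).+1 o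
| ExecWhileStop e c st :
    eval st e = 0 ->
    exec w (While e c) st (ecost e).+1 (Some st)
| ExecWhileLoop e c st st' t1 t2 o :
    eval st e != 0 ->
    exec w c st t1 (Some st') -> exec w (While e c) st' t2 o ->
    exec w (While e c) st (ecost e + t1 + t2).+1 o
| ExecWhileAbort e c st t1 :
    eval st e != 0 ->
    exec w c st t1 None ->
    exec w (While e c) st (ecost e + t1).+1 None.

(** * Concrete syntax *)

Declare Scope exp_scope.
Delimit Scope exp_scope with exp.
Bind Scope exp_scope with exp.
Declare Scope cmd_scope.
Delimit Scope cmd_scope with cmd.
Bind Scope cmd_scope with cmd.
Arguments Cell a%_string i%_exp.

Coercion Reg : string >-> loc.
Coercion Fetch : loc >-> exp.
Coercion Num : nat >-> exp.

Notation "a .[ i ]" := (Cell a i) : exp_scope.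
Notation "e + f" := (Bin OAdd e f) : exp_scope.
Notation "e - f" := (Bin OSub e f) : exp_scope.
Notation "e * f" := (Bin OMul e f) : exp_scope.
Notation "e %/ f" := (Bin ODiv e f) : exp_scope.
Notation "e %% f" := (Bin OMod e f) : exp_scope.
Notation "e < f" := (Bin OLt e f) : exp_scope.
Notation "e == f" := (Bin OEq e f) : exp_scope.
Notation "e && f" := (Bin OAnd e f) : exp_scope.

Notation "l ::= e" := (Assign l%exp e%exp) (at level 60) : cmd_scope.
Notation "l ::=$ e" := (Draw l%exp e%exp) (at level 60) : cmd_scope.
Notation "c ;; d" := (Seq c d) (at level 80, right associativity) : cmd_scope.

Definition For (x : string) (e : exp) (c : cmd) : cmd :=
  (x ::= 0 ;; While (x < e) (c ;; x ::= x + 1))%cmd.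

Local Open Scope string_scope.
Local Open Scope cmd_scope.

(** * The algorithms

    Registers: "n", "m", "z" parameters; "nV", "nE", "nH" numbers of vertices,
    edges and hyperedges.  The vertices are 0, ..., nV - 1; the i-th edge joins
    E1[i] and E2[i]; the k-th hyperedge is H[k m], ..., H[k m + m - 1] (every
    hyperedge has exactly m elements).  A bag is kept as its N distinct elements
    X[0], ..., X[N-1] and their frequencies F[0], ..., F[N-1]. *)

(** Adds the element "x" to the bag.  The array "pos" is never initialized: its
    entry for "x" is trusted only if X confirms it. *)
Definition bag_add : cmd :=
  If (("pos".["x"] < "N") && ("X".["pos".["x"]] == "x"))%exp
     ("F".["pos".["x"]] ::= "F".["pos".["x"]] + 1)
     ("X".["N"] ::= "x" ;; "F".["N"] ::= 1 ;;
      "pos".["x"] ::= "N" ;; "N" ::= "N" + 1).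

(** Fisher-Yates shuffle of the elements, together with their frequencies. *)
Definition shuffle : cmd :=
  For "i" "N"
    ("j" ::=$ "i" + 1 ;;
     "y" ::= "X".["i"] ;; "X".["i"] ::= "X".["j"] ;; "X".["j"] ::= "y" ;;
     "y" ::= "F".["i"] ;; "F".["i"] ::= "F".["j"] ;; "F".["j"] ::= "y").

(** Random systematic sampling from the bag, whose total frequency is "s", with
    sample size "m"; the "q" elements output are put in U.  The frequencies and
    s/m are integers, so that replacing r by its integer part changes none of
    the tests psum > r: r is drawn uniformly from {0, ..., s/m - 1}. *)
Definition RSS : cmd :=
  shuffle ;;
  "r" ::=$ "s" %/ "m" ;;
  "psum" ::= 0 ;;
  "q" ::= 0 ;;
  For "i" "N"
    ("psum" ::= "psum" + "F".["i"] ;;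
     If ("r" < "psum")%exp
        ("U".["q"] ::= "X".["i"] ;; "q" ::= "q" + 1 ;; "r" ::= "r" + "s" %/ "m")
        Skip).

(** Random systematic partitioning of the bag into "s" sets, which are appended
    to the list of hyperedges; L[k] is the current size of the k-th set, and k
    is numbered from 0. *)
Definition RSP : cmd :=
  For "k" "s" ("L".["k"] ::= 0) ;;
  "k" ::= 0 ;;
  shuffle ;;
  For "i" "N"
    (For "c" ("F".["i"])%exp
       ("H".[("nH" + "k") * "m" + "L".["k"]] ::= "X".["i"] ;;
        "L".["k"] ::= "L".["k"] + 1 ;;
        "k" ::= ("k" + 1) %% "s")) ;;
  "nH" ::= "nH" + "s".

Definition SEC_round : cmd :=
  (* the bag of the vertices of z hyperedges drawn with replacement *)
  "N" ::= 0 ;;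
  For "a" "z"
    ("h" ::=$ "nH" ;;
     For "c" "m" ("x" ::= "H".["h" * "m" + "c"] ;; bag_add)) ;;
  "s" ::= "z" * "m" ;;
  RSS ;;
  "v" ::= "nV" ;;
  "nV" ::= "nV" + 1 ;;
  For "c" "m"
    ("E1".["nE"] ::= "U".["c"] ;; "E2".["nE"] ::= "v" ;; "nE" ::= "nE" + 1) ;;
  (* a removed hyperedge is overwritten by the last one of the list *)
  "N" ::= 0 ;;
  For "a" ("m" - 2)%exp
    ("h" ::=$ "nH" ;;
     "nH" ::= "nH" - 1 ;;
     For "c" "m"
       ("x" ::= "H".["h" * "m" + "c"] ;; bag_add ;;
        "H".["h" * "m" + "c"] ::= "H".["nH" * "m" + "c"])) ;;
  For "c" "m" ("x" ::= "v" ;; bag_add) ;;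
  For "c" "m" ("x" ::= "U".["c"] ;; bag_add) ;;
  "s" ::= "m" ;;
  RSP.

Definition SEC_loop : cmd := While ("nV" < "n")%exp SEC_round.

(** Creates the initial hyperedges by RSP, from the vertices with their degrees
    as frequencies. *)
Definition SEC_init : cmd :=
  For "i" "nV" ("X".["i"] ::= "i" ;; "F".["i"] ::= 0) ;;
  "N" ::= "nV" ;;
  For "i" "nE"
    ("F".["E1".["i"]] ::= "F".["E1".["i"]] + 1 ;;
     "F".["E2".["i"]] ::= "F".["E2".["i"]] + 1) ;;
  "nH" ::= 0 ;;
  "s" ::= 2 * "nE" %/ "m" ;;
  RSP.

Definition SEC : cmd := SEC_init ;; SEC_loop.

(** * Inputs and outputs *)

Section Graphs.
Variables (v : nat) (e : rel 'I_v).

Definition simple_graph : Prop := symmetric e /\ irreflexive e.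

Definition connected_graph : Prop :=
  0 < v /\ forall x y : 'I_v, connect e x y.

(** Every edge is listed once, smaller endpoint first. *)
Definition edges : {set 'I_v * 'I_v} :=
  [set p : 'I_v * 'I_v | (p.1 < p.2) && e p.1 p.2].

Definition degree (x : 'I_v) : nat := #|[set y | e x y]|.

Definition initial_graph (m : nat) : Prop :=
  [/\ simple_graph, connected_graph, m %| 2 * #|edges|
    & forall x, degree x <= (2 * #|edges|) %/ m].

Definition initial_hyperedges (m : nat) (H : seq {set 'I_v}) : Prop :=
  [/\ size H = (2 * #|edges|) %/ m,
      forall h, h \in H -> #|h| = m
    & forall x, count (fun h : {set 'I_v} => x \in h) H = degree x].

Definition stores_graph (st : state) : Prop :=
  [/\ regs st "nV" = v, regs st "nE" = #|edges|
    & perm_eq [seq (arrs st "E1" i, arrs st "E2" i) | i <- iota 0 #|edges|]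
              [seq (val p.1, val p.2) | p <- enum edges]].

Definition stores_hyperedges (m : nat) (H : seq {set 'I_v}) (st : state) :
    Prop :=
  regs st "nH" = size H /\
  forall k, k < size H ->
    perm_eq [seq arrs st "H" (k * m + c) | c <- iota 0 m]
            [seq val x | x <- enum (nth set0 H k)].

End Graphs.

Definition stores_params (n m z : nat) (st : state) : Prop :=
  [/\ regs st "n" = n, regs st "m" = m & regs st "z" = z].

(** The rounds select from the list a hyperedge, and m - 2 hyperedges without
    replacement, so the initial list must have at least that many. *)
Definition enough_hyperedges (v : nat) (e : rel 'I_v) (m : nat) : Prop :=
  maxn 1 (m - 2) <= (2 * #|edges e|) %/ m.

Definition creates_graph (n : nat) (o : option state) : Prop :=
  exists st (e : rel 'I_n), [/\ o = Some st, simple_graph e & stores_graph e st].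

(* Main.v *)
(** Running times are bounded by a weakest-precondition calculus in which every
    command carries a time bound; the effect of a command on the registers and
    arrays that do not occur on the left of its assignments is read off the
    syntax.  A round costs O(mz + m^2), since a bag of total frequency k has at
    most k distinct elements and each step handles a bag in time linear in its
    total frequency, which is zm for the sampling and m^2 for the partitioning.

    The rounds preserve that every hyperedge consists of m distinct vertices.
    Hence a vertex has frequency at most z in the first bag, so that RSS outputs
    exactly m distinct vertices and the graph stays simple; and it has frequency
    at most m in the second one, so that RSP, which deals the copies of an
    element to consecutive sets, puts no element twice into the same set.  The
    number of hyperedges grows by 2 in every round, so no draw from the empty
    list occurs unless the initial list is too short, in which case the first
    round aborts. *)

From Stdlib Require Import String.
Require Import Defs.
From mathcomp Require Import all_boot zify.

Set Implicit Arguments.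
Unset Strict Implicit.
Unset Printing Implicit Defensive.

Local Open Scope string_scope.
Local Open Scope seq_scope.
Local Open Scope nat_scope.

(** * Frames read off the syntax of commands *)

Fixpoint writes_reg (c : cmd) (x : string) : bool :=
  match c with
  | Skip => false
  | Assign (Reg y) _ | Draw (Reg y) _ => String.eqb x y
  | Assign _ _ | Draw _ _ => false
  | Seq c1 c2 | If _ c1 c2 => writes_reg c1 x || writes_reg c2 x
  | While _ c => writes_reg c x
  end.

Fixpoint writes_arr (c : cmd) (a : string) : bool :=
  match c with
  | Skip => false
  | Assign (Cell b _) _ | Draw (Cell b _) _ => String.eqb a b
  | Assign _ _ | Draw _ _ => false
  | Seq c1 c2 | If _ c1 c2 => writes_arr c1 a || writes_arr c2 a
  | While _ c => writes_arr c a
  end.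

Definition frame (c : cmd) (st st' : state) : Prop :=
  (forall x, ~~ writes_reg c x -> regs st' x = regs st x) /\
  (forall a, ~~ writes_arr c a -> arrs st' a = arrs st a).

Lemma frame_refl c st : frame c st st.
Proof. by []. Qed.

Lemma frame_trans c st1 st2 st3 :
  frame c st1 st2 -> frame c st2 st3 -> frame c st1 st3.
Proof.
move=> [r12 a12] [r23 a23]; split=> x nx; first by rewrite r23 ?r12.
by rewrite a23 ?a12.
Qed.

Lemma frame_sub c c' st st' :
  (forall x, writes_reg c x -> writes_reg c' x) ->
  (forall a, writes_arr c a -> writes_arr c' a) ->
  frame c st st' -> frame c' st st'.
Proof.
move=> sr sa [fr fa]; split=> x nx.
  by apply: fr; apply: contraNN nx; apply: sr.
by apply: fa; apply: contraNN nx; apply: sa.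
Qed.

Lemma frame_assign l e k st : frame (Assign l e) st (store st l k).
Proof.
case: l => [y|b i]; split=> x //=; first by case: (String.eqb x y).
by case: (String.eqb x b).
Qed.

(** This lets every later specification mention only what changes: unwritten registers and whole
    arrays are carried over by rewriting with the two halves of the frame. An aborted run has no
    final state and satisfies this vacuously. *)
Lemma exec_frame w c st t o :
  exec w c st t o -> forall st', o = Some st' -> frame c st st'.
Proof.
elim=> {c st t o} //=.
- by move=> st st' [<-].
- by move=> l e st st' [<-]; apply: frame_assign.
- by move=> l e st k _ st' [<-]; apply: (frame_assign l e).
- move=> c1 c2 st st1 t1 t2 o _ IH1 _ IH2 st' /IH2 f2.
  apply: (@frame_trans _ _ st1).
    by apply: frame_sub (IH1 _ erefl) => x /= ->.
  by apply: frame_sub f2 => x /= ->; rewrite orbT.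
- move=> e c1 c2 st t o _ IH st' /IH.
  by case: ifP => _; apply: frame_sub => x /= ->; rewrite ?orbT.
- by move=> e c st _ st' [<-].
- move=> e c st st1 t1 t2 o _ _ IH1 _ IH2 st' /IH2 f2.
  exact: frame_trans (IH1 _ erefl) f2.
Qed.

(** [A] is the condition under which an abort is tolerated. *)
Definition wp (w : tape) (A : Prop) (c : cmd) (st : state) (T : nat)
    (Q : state -> Prop) : Prop :=
  exists t o, [/\ exec w c st t o, t <= T & if o is Some st' then Q st' else A].

(** * Rules of the timed weakest-precondition calculus *)

Section Rules.
Variables (w : tape) (A : Prop).
Local Notation wp := (wp w A).

Lemma wp_conseq c st T T' (Q Q' : state -> Prop) :
  wp c st T Q -> T <= T' ->
  (forall st', frame c st st' -> Q st' -> Q' st') -> wp c st T' Q'.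
Proof.
move=> [t [o [ex tT Qo]]] TT' QQ'; exists t, o; split=> //.
  exact: leq_trans TT'.
case: o ex Qo => // st' ex; apply: QQ'; exact: exec_frame ex _ erefl.
Qed.

Lemma wp_seq c1 c2 st T1 T2 T Q1 Q :
  wp c1 st T1 Q1 ->
  (forall st', frame c1 st st' -> Q1 st' -> wp c2 st' T2 Q) ->
  T1 + T2 < T -> wp (Seq c1 c2) st T Q.
Proof.
move=> [t1 [[st1|] [ex1 tT1 Q1o]]] H lT.
  have [t2 [o [ex2 tT2 Qo]]] := H _ (exec_frame ex1 erefl) Q1o.
  exists (t1 + t2).+1, o; split=> //; last by lia.
  exact: ExecSeq ex1 ex2.
exists t1.+1, None; split=> //; last by lia.
exact: ExecSeqAbort.
Qed.

(** Asking for the postcondition at every value below the bound makes the tape disappear from all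
    later arguments. *)
Lemma wp_draw l e st T Q :
  ecost (Fetch l) + ecost e < T ->
  (eval st e = 0 -> A) ->
  (forall k, k < eval st e -> Q (count_draw (store st l k))) ->
  wp (Draw l e) st T Q.
Proof.
move=> cT abortOK HQ; exists (lcost l + ecost e).+1.
case Ee: (eval st e) => [|k].
  exists None; split; [exact: ExecDrawEmpty | by [] | exact: abortOK].
exists (Some (count_draw (store st l (w (draws st) k)))); split=> //.
  exact: ExecDraw.
by apply: HQ; rewrite Ee.
Qed.

Lemma wp_draw_seq l e c st T2 T Q :
  (eval st e = 0 -> A) ->
  (forall k, k < eval st e -> wp c (count_draw (store st l k)) T2 Q) ->
  ecost (Fetch l) + ecost e + T2 + 1 < T ->
  wp (Seq (Draw l e) c) st T Q.
Proof.
move=> abortOK HQ lT; apply: (wp_seq (T2 := T2) (T1 := (ecost (Fetch l) + ecost e).+1)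
  (Q1 := fun st' => exists2 k, k < eval st e & st' = count_draw (store st l k))).
- by apply: wp_draw => // k ltk; exists k.
- by move=> _ _ [k ltk ->]; apply: HQ.
- lia.
Qed.

(** The index of [I] is the number of iterations still to come, so induction on it gives termination
    together with the bound; [f k] pays for the iteration after which [k] remain. *)
Lemma wp_while (e : exp) c st n (f : nat -> nat) (I : nat -> state -> Prop) :
  I n st ->
  (forall k st', I k st' -> (eval st' e == 0) = (k == 0)) ->
  (forall k st', I k.+1 st' -> wp c st' (f k) (I k)) ->
  wp (While e c) st (\sum_(k < n) f k + n * (ecost e).+1 + (ecost e).+1) (I 0).
Proof.
move=> In test body; elim: n st In => [|n IH] st In.
  exists (ecost e).+1, (Some st); split=> //; last by rewrite big_ord0; lia.
  by apply: ExecWhileStop; apply/eqP; rewrite (test _ _ In).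
have e0: eval st e != 0 by rewrite (test _ _ In).
rewrite big_ord_recr /=.
have [t1 [[st1|] [ex1 tT1 Q1]]] := body _ _ In; last first.
  exists (ecost e + t1).+1, None; split=> //; last by lia.
  exact: ExecWhileAbort.
have [t2 [o [ex2 tT2 Qo]]] := IH _ Q1.
exists (ecost e + t1 + t2).+1, o; split=> //; first exact: ExecWhileLoop ex1 ex2.
move: (\sum_(i < n) f i) tT2 tT1 => S; rewrite mulSn; lia.
Qed.

Fixpoint straight (c : cmd) : bool :=
  match c with
  | Skip | Assign _ _ => true
  | Seq c1 c2 | If _ c1 c2 => straight c1 && straight c2
  | Draw _ _ | While _ _ => false
  end.

Fixpoint run (c : cmd) (st : state) : state :=
  match c with
  | Assign l e => store st l (eval st e)
  | Seq c1 c2 => run c2 (run c1 st)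
  | If e c1 c2 => if eval st e != 0 then run c1 st else run c2 st
  | _ => st
  end.

Fixpoint cost (c : cmd) : nat :=
  match c with
  | Skip => 1
  | Assign l e => (ecost (Fetch l) + ecost e).+1
  | Seq c1 c2 => (cost c1 + cost c2).+1
  | If e c1 c2 => (ecost e + maxn (cost c1) (cost c2)).+1
  | Draw _ _ | While _ _ => 0
  end.

(** For code without loops and draws the calculus is symbolic execution: simplification leaves a
    property of the computed state. *)
Lemma wp_run c st T (Q : state -> Prop) :
  straight c -> cost c <= T -> Q (run c st) -> wp c st T Q.
Proof.
move=> sc cT HQ.
suff [t [ex tc]] : exists t, exec w c st t (Some (run c st)) /\ t <= cost c.
  by exists t, (Some (run c st)); split=> //; apply: leq_trans cT.
elim: c st sc {Q HQ cT T} => //=.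
- by move=> st _; exists 1; split=> //; apply: ExecSkip.
- by move=> l e st _; eexists; split; [apply: ExecAssign|].
- move=> c1 IH1 c2 IH2 st /andP[/IH1 s1 /IH2 s2].
  have [t1 [ex1 tT1]] := s1 st; have [t2 [ex2 tT2]] := s2 (run c1 st).
  exists (t1 + t2).+1; split; [exact: ExecSeq ex1 ex2 | lia].
- move=> e c1 IH1 c2 IH2 st /andP[/IH1 s1 /IH2 s2].
  have [t1 [ex1 tT1]] := s1 st; have [t2 [ex2 tT2]] := s2 st.
  case: (boolP (eval st e != 0)) => e0.
    exists (ecost e + t1).+1; split; last by lia.
    by apply: ExecIf; rewrite e0.
  exists (ecost e + t2).+1; split; last by lia.
  by apply: ExecIf; rewrite (negPf e0).
Qed.

(** The bound [e] is evaluated anew at each test, hence the hypothesis that it keeps the value [n].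
    Each iteration pays [ecost e + 3] for the test and 6 for the increment and its sequencing; the
    last test and the initialization account for [ecost e + 7]. *)
Lemma wp_for x e c n (f : nat -> nat) st (T : nat) (I : nat -> state -> Prop) :
  ~~ writes_reg c x ->
  \sum_(i < n) f i + n * (ecost e + 9) + (ecost e + 7) <= T ->
  I 0 (store st (Reg x) 0) ->
  (forall i st', i <= n -> frame (For x e c) st st' -> I i st' ->
     eval st' e = n) ->
  (forall i st', i < n -> frame (For x e c) st st' -> regs st' x = i ->
     I i st' -> wp c st' (f i) (fun st'' => I i.+1 (store st'' (Reg x) i.+1))) ->
  wp (For x e c) st T (I n).
Proof.
move=> ncx lT I0 bound body.
have frameS st' st'' k : frame (For x e c) st st' -> frame c st' st'' ->
    frame (For x e c) st (store st'' (Reg x) k).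
  move=> fr0 fr; apply: (frame_trans fr0); apply: (@frame_trans _ _ st'').
    by apply: frame_sub fr => y /= ->; rewrite ?orbT.
  by apply: frame_sub (frame_assign (Reg x) e k st'') => y //= ->.
(* [I] counts upwards from 0 while [wp_while] counts the remaining iterations down; [J] translates
   between the two. *)
pose J k st' := [/\ k <= n, frame (For x e c) st st', regs st' x = n - k
  & I (n - k) st'].
have J0 : J n (store st (Reg x) 0).
  split; rewrite ?subnn //=; last by rewrite String.eqb_refl.
  by apply: (frameS st); apply: frame_refl.
pose c' := Seq c (Assign (Reg x) (Bin OAdd (Reg x) (Defs.Num 1))).
have /= := @wp_while (Bin OLt (Reg x) e) c' _ n (fun k => f (n - k.+1) + 6) J J0.
case.
- move=> k st' [kn fr xk Ik] /=; rewrite xk (bound _ _ _ fr Ik) ?leq_subr //.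
  lia.
- move=> k st' [kn fr xk Ik].
  apply: (wp_seq (T2 := 5) (body _ _ _ fr xk Ik)); [by lia | | by lia].
  move=> st'' fr' Ik'; apply: wp_run => //=.
  rewrite fr'.1 // xk; have -> : n - k.+1 + 1 = n - k by lia.
  split; [by lia | exact: frameS fr fr' | by rewrite /= String.eqb_refl |].
  by have -> : n - k = (n - k.+1).+1 by lia.
move=> t [o [ex tT Qo]]; exists (3 + t).+1, o; split=> //.
- by apply: ExecSeq ex; apply: (ExecAssign _ (Reg x) (Defs.Num 0)).
- apply: leq_trans lT; move: tT.
  (* The costs come indexed by remaining iterations; reversing the ordinals indexes them by the
     counter. *)
  rewrite big_split /= sum_nat_const card_ord (reindex_inj rev_ord_inj) /=.
  rewrite (eq_bigr (fun i : 'I_n => f i)); first by lia.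
  by move=> i _; congr f; have := ltn_ord i; lia.
- by case: o Qo {ex} => // st' [_ _ _]; rewrite subn0.
Qed.
End Rules.

(** * Bags and their shuffling *)

Lemma mem_mkseq_nat (f : nat -> nat) n x :
  reflect (exists2 i, i < n & x = f i) (x \in mkseq f n).
Proof.
apply: (iffP mapP) => [[i]|[i lti ->]]; first by rewrite mem_iota => lti ->; exists i.
by exists i; rewrite ?mem_iota.
Qed.

Lemma eq_in_mkseq (T : Type) (f g : nat -> T) n :
  (forall i, i < n -> f i = g i) -> mkseq f n = mkseq g n.
Proof.
by move=> fg; apply/eq_in_map => i; rewrite mem_iota => /fg.
Qed.

Lemma mkseq_append (T : Type) (f : nat -> T) x n :
  mkseq (fun i => if i == n then x else f i) (n + 1) = rcons (mkseq f n) x.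
Proof.
rewrite addn1 mkseqS eqxx; congr rcons; apply: eq_in_mkseq => i lti.
by rewrite ltn_eqF.
Qed.

(** Elements of frequency 0 are allowed in X: [SEC_init] puts every vertex
    there, whatever its degree. *)
Definition bag (xs : seq nat) (st : state) : Prop :=
  [/\ uniq (mkseq (arrs st "X") (regs st "N")),
      {subset xs <= mkseq (arrs st "X") (regs st "N")}
    & forall i, i < regs st "N" ->
        arrs st "F" i = count_mem (arrs st "X" i) xs].

(** This holds while a bag is being filled. The bound on [N] makes later loops linear in the total
    frequency; the clause on [pos] is lost in a shuffle, after which only [bag] remains. *)
Definition indexed_bag (xs : seq nat) (st : state) : Prop :=
  [/\ bag xs st, regs st "N" <= size xs
    & forall i, i < regs st "N" -> arrs st "pos" (arrs st "X" i) = i].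

Section Shuffle.
Variables (w : tape) (A : Prop).
Local Notation wp := (wp w A).

(** An arbitrary entry of [pos] is harmless: the test accepts it only if [X] holds [x] there, and a
    stored [x] is always found because [pos] inverts [X]. *)
Lemma wp_bag_add xs st :
  indexed_bag xs st ->
  wp bag_add st 60 (indexed_bag (rcons xs (regs st "x"))).
Proof.
move=> [[uX sX FX] Ns posX]; apply: wp_run => //=.
set x := regs st "x"; set N := regs st "N"; set X := arrs st "X".
rewrite !eqb0 !negbK; case: (boolP (_ && _)) => [/andP[ltN /eqP Xx]|].
  split=> /=; [split=> /= | by rewrite size_rcons leqW | exact: posX]; first by [].

    move=> y; rewrite mem_rcons inE => /orP[/eqP->|/sX //].
    by apply/mem_mkseq_nat; exists (arrs st "pos" x).
  move=> i lti; rewrite -cats1 count_cat /= addn0.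
  case: (i =P _) => [->|neq]; first by rewrite FX // -/X Xx eqxx.
  rewrite FX //; case: eqP => [xXi|]; last by rewrite addn0.
  by case: neq; rewrite xXi posX.
move=> notin.
have {notin} xN : x \notin mkseq X N.
  apply: contra notin => /mem_mkseq_nat[i lti ->]; rewrite posX // lti eqxx //.
have eqX := mkseq_append X x N.
split=> /=; [split=> /= | by rewrite size_rcons addn1 ltnS |].
- by rewrite eqX rcons_uniq xN.
- by move=> y; rewrite eqX !mem_rcons !inE => /orP[->//|/sX->]; rewrite orbT.
- move=> i; rewrite addn1 ltnS leq_eqVlt -cats1 count_cat /= addn0.
  case: (i =P N) => [-> _|_ /= lti].
    by rewrite eqxx addn1 (count_memPn _) //; apply: contra xN => /sX.
  rewrite FX //; case: eqP => [xXi|]; last by rewrite addn0.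
  by case/mem_mkseq_nat: xN; exists i.
- move=> i; rewrite addn1 ltnS leq_eqVlt.
  case: (i =P N) => [-> _|_ /= lti]; first by rewrite eqxx.
  rewrite posX //; case: eqP => // xXi.
  by case/mem_mkseq_nat: xN; exists i.
Qed.

(** Each step of the shuffle is a transposition, so an involution is general enough and no separate
    inverse has to be supplied. *)
Lemma bag_reindex xs st st' (s : nat -> nat) :
  regs st' "N" = regs st "N" ->
  (forall i, i < regs st "N" -> s i < regs st "N") ->
  (forall i, i < regs st "N" -> s (s i) = i) ->
  (forall i, i < regs st "N" -> arrs st' "X" i = arrs st "X" (s i)) ->
  (forall i, i < regs st "N" -> arrs st' "F" i = arrs st "F" (s i)) ->
  bag xs st -> bag xs st'.
Proof.
move=> eqN sN ss X' F' [uX sX FX]; rewrite /bag eqN; split.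
- rewrite (eq_in_mkseq X'); apply/mkseq_uniqP => i j lti ltj eqX.
  rewrite -[LHS]ss // -[RHS]ss //; congr s.
  by move/mkseq_uniqP: uX; apply; rewrite ?inE ?sN.
- move=> x /sX /mem_mkseq_nat[i lti ->]; apply/mem_mkseq_nat.
  by exists (s i); rewrite ?sN // X' ?sN ?ss.
- by move=> i lti; rewrite F' // X' // FX ?sN.
Qed.

Lemma wp_shuffle xs st :
  bag xs st -> wp shuffle st (regs st "N" * 60 + 20) (bag xs).
Proof.
move=> Bst; set N := regs st "N".
apply: (@wp_for _ _ "i" _ _ N (fun=> 50) _ _ (fun _ => bag xs)) => //.
- rewrite /= sum_nat_const card_ord; lia.
- by move=> i st' _ fr _ /=; rewrite fr.1.
move=> i st' lti fr st'i B'.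
apply: (wp_draw_seq (T2 := 42)) => //=; first by rewrite addn1.
rewrite st'i addn1 => j ltj; apply: wp_run => //=; rewrite st'i.
have eqN : regs st' "N" = N by rewrite fr.1.
(* The transposition of [i] and the drawn [j <= i]. *)
pose s k := if k == i then j else if k == j then i else k.
apply: (@bag_reindex _ st' _ s) B' => //=; rewrite ?eqN.
- by move=> k ltk; rewrite /s; case: ifP => _; [|case: ifP => _]; lia.
- move=> k ltk; rewrite /s; have [->|nki] := eqVneq k i.
    by rewrite eqxx; case: eqP.
  have [->|nkj] := eqVneq k j; first by rewrite eqxx.
  by rewrite (negPf nki) (negPf nkj).
- by move=> k ltk; rewrite /s; case: (k =P j) => [->|//]; case: eqP => [->|].
- by move=> k ltk; rewrite /s; case: (k =P j) => [->|//]; case: eqP => [->|].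
Qed.
End Shuffle.

(** Double counting: each element of [s] is matched by exactly one entry of the duplicate-free
    [t]. *)
Lemma sum_count_mem (s t : seq nat) :
  uniq t -> {subset s <= t} -> \sum_(x <- t) count_mem x s = size s.
Proof.
move=> uT; elim: s => [|y s IH] sub; first by rewrite big1.
rewrite /= big_split /= IH; last by move=> x xs; rewrite sub // inE xs orbT.
by rewrite -big_mkcond sum1_count (eq_count (a2 := pred1 y)) ?count_uniq_mem ?sub
  ?mem_head // => x /=; rewrite eq_sym.
Qed.

Lemma sum_bag xs st :
  bag xs st -> \sum_(i < regs st "N") arrs st "F" i = size xs.
Proof.
case=> uX sX FX; rewrite -(sum_count_mem uX sX) big_map.
rewrite -[iota 0 _]/(iota 0 (regs st "N")) -[in iota 0 _](subn0 (regs st "N")).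
rewrite -/(index_iota 0 _) big_mkord.
by apply: eq_bigr => i _; rewrite FX.
Qed.

Definition hyperedge (st : state) (m k : nat) : seq nat :=
  mkseq (fun c => arrs st "H" (k * m + c)) m.

(** * Random systematic sampling *)

Section Sampling.
Variables (w : tape) (A : Prop).
Local Notation wp := (wp w A).

(** The step [s %/ m] equals [z], and no frequency exceeds it, so one increase of [r] always lifts
    it back to at least [psum]. Thus one test per element misses no output, and the sample is a
    subsequence of the shuffled distinct elements. *)
Lemma wp_RSS xs z m st :
  bag xs st -> regs st "s" = z * m -> regs st "m" = m -> 0 < z -> 0 < m ->
  size xs = z * m -> (forall x, count_mem x xs <= z) ->
  wp RSS st (regs st "N" * 120 + 100)
    (fun st' => uniq (mkseq (arrs st' "U") m) /\
                {subset mkseq (arrs st' "U") m <= xs}).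
Proof.
move=> B0 eqs eqm z0 m0 szxs cntxs.
have divs : z * m %/ m = z by rewrite mulnK.
apply: (wp_seq (T2 := regs st "N" * 60 + 70) (wp_shuffle _ _ B0));
  last by lia.
move=> st1 [fr1 fa1] B1.
have eqN1 : regs st1 "N" = regs st "N" by rewrite fr1.
rewrite -eqN1; set N := regs st1 "N".
have sumF : \sum_(j < N) arrs st1 "F" j = z * m by rewrite (sum_bag B1).
case: (B1) => uX _ FX.
apply: (wp_draw_seq (T2 := N * 60 + 60)) => /=; last by lia.
  by rewrite fr1 // fr1 // eqs eqm divs; lia.
rewrite !fr1 // eqs eqm divs => r0 ltr0.
(* The threshold [r] stays in a window of length [z] starting at [psum], which at the end determines
   the number [q] of outputs. *)
pose I i st' := let q := regs st' "q" in let psum := regs st' "psum" in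
  let r := regs st' "r" in
  [/\ subseq (mkseq (arrs st' "U") q) (mkseq (arrs st1 "X") i),
      {subset mkseq (arrs st' "U") q <= xs},
      psum = \sum_(j < i) arrs st1 "F" j,
      psum <= r < psum + z & r = r0 + q * z].
apply: (@wp_seq _ _ _ _ _ 3 (N * 60 + 50) _
  (fun st' => st' = store (count_draw (store st1 "r" r0)) "psum" 0)); last by lia.
  exact: wp_run.
move=> _ _ ->.
apply: (@wp_seq _ _ _ _ _ 3 (N * 60 + 40) _
  (fun st' => st' = store (store (count_draw (store st1 "r" r0)) "psum" 0) "q" 0));
  last by lia.
  exact: wp_run.
move=> _ _ ->.
apply: (@wp_conseq _ _ _ _ (N * 60 + 30) _ (I N)); last 1 first.
- move=> st' _ [sub subxs ps /andP[ler ltr] eqr].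
  suff eqq : regs st' "q" = m.
    by rewrite -eqq; split=> //; apply: subseq_uniq uX.
  move: ler ltr; rewrite ps sumF eqr => ler ltr.
  (* From [z * m <= r0 + q * z < z * m + z] and [r0 < z] follow both [m <= q] and [q <= m]. *)
  have : z * m < (regs st' "q").+1 * z by lia.
  rewrite mulnC ltn_pmul2r // => le1.
  have : regs st' "q" * z < m.+1 * z by lia.
  by rewrite ltn_pmul2r // => le2; lia.
- apply: (wp_for (n := N) (f := fun=> 50)) => //.
  + by rewrite sum_nat_const card_ord /=; lia.
  + by rewrite /I /= big_ord0; split=> //; lia.
  + by move=> i st' _ [fr _] _ /=; rewrite fr.
  move=> i st' lti [fr fa] st'i [sub subxs ps /andP[ler ltr] eqr].
  have eqX : arrs st' "X" = arrs st1 "X" by rewrite fa.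
  have eqF : arrs st' "F" = arrs st1 "F" by rewrite fa.
  have eqsm : regs st' "s" %/ regs st' "m" = z.
    by rewrite fr // fr //= !fr1 // eqs eqm.
  apply: wp_run => //=.
  have Fz : arrs st1 "F" i <= z by rewrite FX.
  (* An output needs [psum] to pass [r], hence a positive frequency; entries of frequency 0 cannot
     be sampled. *)
  have Fpos : 0 < arrs st1 "F" i -> arrs st1 "X" i \in xs.
    by rewrite FX // -has_count has_pred1.
  rewrite eqsm eqX eqF st'i eqb0 negbK; case: ltnP => [ltrp|lepr].
  + split.
    * rewrite mkseq_append mkseqS -!cats1; exact: cat_subseq.
    * move=> x; rewrite mkseq_append mem_rcons inE.
      by case/orP=> [/eqP->|/subxs//]; apply: Fpos; lia.
    * by rewrite big_ord_recr /= -ps.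
    * by rewrite /=; lia.
    * by rewrite /= eqr; lia.
  + split=> //.
    * by rewrite mkseqS -cats1; apply: subseq_trans sub (prefix_subseq _ _).
    * by rewrite big_ord_recr /= -ps.
    * by rewrite /=; lia.
- lia.
Qed.
End Sampling.

(** * Random systematic partitioning *)

Lemma cell_inj m k k' c c' : c < m -> c' < m ->
  (k * m + c == k' * m + c') = (k == k') && (c == c').
Proof.
move=> ltc ltc'; apply/eqP/andP => [eqkc|[/eqP-> /eqP->] //].
have m0 : 0 < m by lia.
have := congr1 (divn^~ m) eqkc; rewrite !divnMDl // !divn_small // !addn0 => ->.
by have := congr1 (modn^~ m) eqkc; rewrite !modnMDl !modn_small // => ->.
Qed.

(** The number of positions below [p] that are congruent to [k] modulo [s] is
    [p %/ s + (k < p %% s)]. *)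
Lemma dealt_succ p s k : k < s ->
  (if k == p %% s then p %/ s + 1 else p %/ s + (k < p %% s)) =
  p.+1 %/ s + (k < p.+1 %% s).
Proof.
move=> ltk; have s0 : 0 < s by lia.
have eqp : p.+1 = p %/ s * s + (p %% s).+1 by rewrite addnS -divn_eq.
have := ltn_pmod p s0; rewrite leq_eqVlt => /orP[/eqP eqs|lts].
  have -> : p.+1 = (p %/ s).+1 * s by rewrite eqp eqs; lia.
  by rewrite mulnK // modnMl; case: eqP => ?; lia.
rewrite eqp divnMDl // modnMDl (modn_small lts) (divn_small lts).
by case: eqP => ?; lia.
Qed.

Section Partitioning.
Variables (w : tape) (A : Prop).
Local Notation wp := (wp w A).

(** Positions dealt to one set differ by multiples of [s], whereas the copies of one element fill at
    most [s] consecutive positions. Since there are [s * m] positions, each set gets exactly [m]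
    elements. *)
Lemma wp_RSP xs s m st :
  bag xs st -> regs st "s" = s -> regs st "m" = m -> size xs = s * m ->
  (forall x, count_mem x xs <= s) ->
  wp RSP st ((s + regs st "N" + s * m) * 120 + 100)
    (fun st' => [/\ regs st' "nH" = regs st "nH" + s,
       forall k, k < regs st "nH" -> hyperedge st' m k = hyperedge st m k
     & forall k, regs st "nH" <= k < regs st "nH" + s ->
         uniq (hyperedge st' m k) /\ {subset hyperedge st' m k <= xs}]).
Proof.
move=> B0 eqs eqm szxs cntxs.
pose I0 i st' := forall k, k < i -> arrs st' "L" k = 0.
apply: (@wp_seq _ _ _ _ _ (s * 20 + 20)
  (regs st "N" * 120 + (s * m) * 120 + 70) _ (I0 s)); last by lia.
  apply: (wp_for (n := s) (f := fun=> 10)) => //.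
  - by rewrite sum_nat_const card_ord /=; lia.
  - by move=> i st' _ fr _ /=; rewrite fr.1.
  move=> i st' lti fr st'i Ii; apply: wp_run => //= k ltk /=.
  by rewrite st'i; case: eqP => // ?; apply: Ii; lia.
move=> st1 fr1 L0.
apply: (@wp_seq _ _ _ _ _ 3 (regs st "N" * 120 + (s * m) * 120 + 60) _
  (fun st' => st' = store st1 "k" 0)); last by lia.
  exact: wp_run.
move=> st2 fr2 eqst2.
have B2 : bag xs st2.
  case: B0 => uX sX FX.
  by rewrite /bag eqst2 /= !fr1.1 // !fr1.2.
have eqN2 : regs st2 "N" = regs st "N" by rewrite fr2.1 // fr1.1.
apply: (wp_seq (T2 := regs st "N" * 60 + (s * m) * 120 + 30)
  (wp_shuffle _ _ B2)); last by rewrite eqN2; lia.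
move=> st3 fr3 B3.
have eqN3 : regs st3 "N" = regs st "N" by rewrite fr3.1.
have eqs3 : regs st3 "s" = s by rewrite fr3.1 // fr2.1 // fr1.1.
have eqm3 : regs st3 "m" = m by rewrite fr3.1 // fr2.1 // fr1.1.
have eqnH3 : regs st3 "nH" = regs st "nH" by rewrite fr3.1 // fr2.1 // fr1.1.
have eqH3 : arrs st3 "H" = arrs st "H" by rewrite fr3.2 // fr2.2 // fr1.2.
have k3 : regs st3 "k" = 0 by rewrite fr3.1 // eqst2.
have L3 k : k < s -> arrs st3 "L" k = 0.
  by move=> ltk; rewrite fr3.2 // eqst2 /= L0.
case: (B3) => /mkseq_uniqP uX _ FX.
rewrite -eqN3 -eqnH3; set N := regs st3 "N"; set nH := regs st3 "nH".
have sumF : \sum_(j < N) arrs st3 "F" j = s * m by rewrite (sum_bag B3).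
set F := arrs st3 "F" in FX sumF *; set X := arrs st3 "X" in uX FX.
(* The copies of X[j] are dealt at the positions S j, ..., S j.+1 - 1; position
   p goes to the set p %% s, as its element number p %/ s. *)
pose S i := \sum_(j < i) F j.
have SS i : S i.+1 = S i + F i by rewrite /S big_ord_recr.
have S_mono : {homo S : i j / i <= j}.
  by apply: homo_leq leqnn leq_trans _ => i; rewrite SS leq_addr.
(* The third clause records the source index [j] with its interval of positions, since distinctness
   is proved by comparing positions. The last one protects the older hyperedges. *)
pose dealt p st' := [/\ regs st' "k" = p %% s,
  forall k, k < s -> arrs st' "L" k = p %/ s + (k < p %% s),
  forall k l, k < s -> l * s + k < p -> exists j, [/\ j < N,
    S j <= l * s + k < S j.+1 & arrs st' "H" ((nH + k) * m + l) = X j]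
  & forall a, a < nH * m -> arrs st' "H" a = arrs st "H" a].
apply: (@wp_seq _ _ _ _ _ (N * 60 + (s * m) * 120 + 20) 8 _ (dealt (s * m)));
  last by lia.
(* The inner loop costs a multiple of [F i] plus a constant; [sumF] turns the total into a bound
   linear in [s * m] and [N]. *)
- rewrite -sumF.
  apply: (@wp_for _ _ "i" _ _ N (fun i => F i * 100 + 40) _ _
    (fun i => dealt (S i))) => //.
  + rewrite big_split /= sum_nat_const card_ord -big_distrl /=; lia.
  + rewrite /dealt /S big_ord0 mod0n div0n /= k3; rewrite eqH3.
    by split=> // k ltk; rewrite L3.
  + by move=> i st' _ fr _ /=; rewrite fr.1.
  move=> i st4 ltiN fr4 st4i D4.
  rewrite SS.
  apply: (@wp_for _ _ "c" _ _ (F i) (fun=> 60) _ _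
    (fun c => dealt (S i + c))) => //.
  + rewrite sum_nat_const card_ord /=; lia.
  + by rewrite addn0.
  + by move=> c st5 _ fr _ /=; rewrite fr.1 // fr.2 // st4i fr4.2.
  move=> c st5 ltc fr5 st5c [k5 L5 deal5 H5].
  apply: wp_run => //; rewrite addnS; set p := S i + c in k5 L5 deal5 *.
  (* Staying below the total frequency yields [0 < s] and [p %/ s < m], so the write remains among
     the [m] slots of its set. *)
  have ltp : p < s * m by have := S_mono _ _ ltiN; rewrite SS [S N]sumF /p; lia.
  have s0 : 0 < s by case: (s) ltp.
  have eqs5 : regs st5 "s" = s by rewrite fr5.1 // fr4.1.
  have eqm5 : regs st5 "m" = m by rewrite fr5.1 // fr4.1.
  have eqnH5 : regs st5 "nH" = nH by rewrite fr5.1 // fr4.1.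
  have eqX5 : arrs st5 "X" i = X i by rewrite fr5.2 // fr4.2.
  have eqi5 : regs st5 "i" = i by rewrite fr5.1.
  have ltks := ltn_pmod p s0.
  have ltqm : p %/ s < m by rewrite ltn_divLR // mulnC.
  split=> /=; rewrite ?eqs5 ?eqm5 ?eqnH5 ?k5 ?eqi5 ?eqX5 ?(L5 _ ltks) ?ltnn ?addn0.
  + by rewrite addn1 -[in RHS]addn1 -modnDml addn1.
  + move=> k ltk; rewrite -dealt_succ //; case: eqP => // _; exact: L5.
  + move=> k l ltk ltkl.
    have ltl : l < m by nia.
    rewrite cell_inj // eqn_add2l; case: ifP => [/andP[/eqP-> /eqP->]|neq].
      exists i; split=> //; rewrite -divn_eq SS /p; lia.
    (* A position different from [p] lies below [p] and was treated before; the position [p] itself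
       would have matched the written cell. *)
    apply: deal5 => //; rewrite ltn_neqAle -ltnS ltkl andbT.
    apply: contraFN neq => /eqP <-.
    by rewrite modnMDl modn_small // divnMDl // divn_small // addn0 !eqxx.
  + move=> a lta; case: eqP => [eqa|_]; last exact: H5.
    by nia.
move=> st4 fr4 [_ _ deal4 H4]; apply: wp_run => //=.
rewrite fr4.1 // [regs st4 "s"]fr4.1 // eqs3 -/nH; split=> //.
  move=> k ltk; apply: eq_in_mkseq => c ltc; apply: H4; nia.
move=> k /andP[lek ltk].
have ltk' : k - nH < s by lia.
have deal c : c < m -> exists j, [/\ j < N,
    S j <= c * s + (k - nH) < S j.+1 & arrs st4 "H" (k * m + c) = X j].
  move=> ltc; have := deal4 (k - nH) c ltk'; rewrite subnKC //.
  apply; nia.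
split.
  apply/mkseq_uniqP => c c' ltc ltc' /=.
  have [j [ltj /andP[le lt] ->]] := deal c ltc.
  have [j' [ltj' /andP[le' lt'] ->]] := deal c' ltc'.
  (* Equal entries come from the same [j]; slots [c] and [c'] are at positions [s * |c - c'|] apart
     inside an interval of length [F j <= s], so they coincide. *)
  move/(uX _ _ ltj ltj') => eqj; rewrite -{j'}eqj in ltj' le' lt'.
  have Fs : F j <= s by rewrite FX.
  rewrite SS in lt lt'; apply/eqP; rewrite eqn_leq; apply/andP; split; nia.
move=> x /mem_mkseq_nat[c ltc ->].
have [j [ltj /andP[le lt] /= ->]] := deal c ltc.
rewrite SS in lt; have : 0 < F j by lia.
by rewrite FX // -has_count has_pred1.
Qed.
End Partitioning.

(** * The loops that make up a round *)

Local Open Scope cmd_scope.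

(** This and the following commands are pieces of [SEC_round], named so that each loop gets its own
    specification; conversion identifies them with the program. *)
Definition read_hyperedge : exp := ("H".["h" * "m" + "c"])%exp.

Definition add_all (e : exp) : cmd :=
  For "c" "m" ("x" ::= e ;; bag_add).

Definition sample_hyperedges : cmd :=
  For "a" "z" ("h" ::=$ "nH" ;; add_all read_hyperedge).

Definition add_edges : cmd :=
  For "c" "m"
    ("E1".["nE"] ::= "U".["c"] ;; "E2".["nE"] ::= "v" ;; "nE" ::= "nE" + 1).

Definition remove_hyperedges : cmd :=
  For "a" ("m" - 2)%exp
    ("h" ::=$ "nH" ;;
     "nH" ::= "nH" - 1 ;;
     For "c" "m"
       ("x" ::= read_hyperedge ;; bag_add ;;
        "H".["h" * "m" + "c"] ::= "H".["nH" * "m" + "c"])).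

Local Close Scope cmd_scope.

Definition hyperedges_ok (v m nH : nat) (st : state) : Prop :=
  forall k, k < nH ->
    uniq (hyperedge st m k) /\ {subset hyperedge st m k <= gtn v}.

(** What the proof uses of a union, with multiplicities, of [a] hyperedges. *)
Definition union_of (v m a : nat) (xs : seq nat) : Prop :=
  [/\ size xs = a * m, forall x, count_mem x xs <= a & {subset xs <= gtn v}].

Lemma union_of_cat v m a xs t :
  size t = m -> uniq t -> {subset t <= gtn v} ->
  union_of v m a xs -> union_of v m a.+1 (xs ++ t).
Proof.
move=> szt ut tv [szxs cntxs xsv]; split.
- by rewrite size_cat szxs szt mulSn addnC.
- by move=> x; rewrite count_cat (count_uniq_mem x ut); have := cntxs x; lia.
- by move=> x; rewrite mem_cat => /orP[/xsv|/tv].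
Qed.

Definition edge_list (st : state) : seq (nat * nat) :=
  mkseq (fun i => (arrs st "E1" i, arrs st "E2" i)) (regs st "nE").

Section RoundLoops.
Variables (w : tape) (A : Prop).
Local Notation wp := (wp w A).

(** The expression is a parameter because the same loop adds a hyperedge, the copies of the new
    vertex, and the sample. *)
Lemma wp_add_all e (f : nat -> nat) m xs st :
  ecost e <= 10 -> regs st "m" = m ->
  (forall c st', c < m -> frame (add_all e) st st' -> regs st' "c" = c ->
     eval st' e = f c) ->
  indexed_bag xs st ->
  wp (add_all e) st (m * 100 + 20) (indexed_bag (xs ++ mkseq f m)).
Proof.
move=> coste eqm evale B0.
apply: (wp_for (n := m) (f := fun=> 80)
  (I := fun c => indexed_bag (xs ++ mkseq f c))) => //.
- by rewrite sum_nat_const card_ord /=; lia.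
- by rewrite cats0.
- by move=> i st' _ fr _ /=; rewrite fr.1.
move=> c st' ltc fr st'c B'.
apply: (@wp_seq _ _ _ _ _ 15 60 _
  (fun st'' => st'' = store st' "x" (f c))); last by lia.
  by apply: wp_run => /=; [|lia|rewrite (evale c)].
move=> _ _ ->; apply: (wp_conseq (wp_bag_add w A (xs := xs ++ mkseq f c) _)) => //.
by move=> st'' _ /=; rewrite rcons_cat -mkseqS.
Qed.

Lemma wp_sample_hyperedges v m z nH st :
  regs st "m" = m -> regs st "z" = z -> regs st "nH" = nH ->
  (nH = 0 -> A) -> hyperedges_ok v m nH st -> indexed_bag [::] st ->
  wp sample_hyperedges st (z * (m * 100 + 50) + 20)
    (fun st' => exists2 xs, indexed_bag xs st' & union_of v m z xs).
Proof.
move=> eqm eqz eqnH abortOK okH B0.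
apply: (wp_for (n := z) (f := fun=> m * 100 + 30)
  (I := fun a st' => exists2 xs, indexed_bag xs st' & union_of v m a xs)) => //.
- by rewrite sum_nat_const card_ord /=; lia.
- by exists [::].
- by move=> i st' _ fr _ /=; rewrite fr.1.
move=> a st' lta fr st'a [xs Bxs Uxs].
have nH' : regs st' "nH" = nH by rewrite fr.1.
apply: (wp_draw_seq (T2 := m * 100 + 20)) => /=; [ |rewrite nH' => h lth|lia].
  by rewrite nH'.
pose f c := arrs st "H" (h * m + c).
apply: (wp_conseq (T := m * 100 + 20)
  (Q := indexed_bag (xs ++ mkseq f m))) => //.
  apply: wp_add_all => //; first by rewrite /= fr.1.
  move=> c st2 ltc fr2 st2c.
  by rewrite /= fr2.2 // fr2.1 // fr2.1 // st2c /= fr.2 // fr.1 // eqm.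
move=> st2 _ B2; exists (xs ++ mkseq f m) => //.
by have [uh hv] := okH h lth; apply: union_of_cat => //; rewrite size_mkseq.
Qed.

Lemma wp_add_edges m v st :
  regs st "m" = m -> regs st "v" = v ->
  wp add_edges st (m * 40 + 20)
    (fun st' => edge_list st' =
       edge_list st ++ mkseq (fun c => (arrs st "U" c, v)) m).
Proof.
move=> eqm eqv.
apply: (wp_for (n := m) (f := fun=> 25) (I := fun c st' => edge_list st' =
  edge_list st ++ mkseq (fun c => (arrs st "U" c, v)) c)) => //.
- by rewrite sum_nat_const card_ord /=; lia.
- by rewrite cats0.
- by move=> i st' _ fr _ /=; rewrite fr.1.
move=> c st' ltc fr st'c E'; apply: wp_run => //.
rewrite mkseqS -rcons_cat -E' -mkseq_append /edge_list /= st'c.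
apply: eq_in_mkseq => i _; rewrite (fr.1 "v") // eqv (fr.2 "U") //.
by case: eqP.
Qed.

(** Moving the last hyperedge into the gap keeps the survivors contiguous, so the next draw is again
    from an initial segment of the list. *)
Lemma wp_remove_hyperedges v m nH st :
  regs st "m" = m -> regs st "nH" = nH ->
  (nH < m - 2 -> A) -> hyperedges_ok v m nH st -> indexed_bag [::] st ->
  wp remove_hyperedges st ((m - 2) * (m * 150 + 60) + 20)
    (fun st' => regs st' "nH" + (m - 2) = nH /\
       exists xs, [/\ indexed_bag xs st', union_of v m (m - 2) xs
         & hyperedges_ok v m (regs st' "nH") st']).
Proof.
move=> eqm eqnH abortOK okH B0.
apply: (wp_for (n := m - 2) (f := fun=> m * 150 + 40)
  (I := fun a st' => regs st' "nH" + a = nH /\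
       exists xs, [/\ indexed_bag xs st', union_of v m a xs
         & hyperedges_ok v m (regs st' "nH") st'])) => //.
- by rewrite sum_nat_const card_ord /=; lia.
- by rewrite addn0; split=> //; exists [::]; rewrite /= eqnH.
- by move=> i st' _ fr _ /=; rewrite fr.1 ?eqm.
move=> a st' lta fr st'a [nH' [xs [Bxs Uxs okH']]].
have m' : regs st' "m" = m by rewrite fr.1.
apply: (wp_draw_seq (T2 := m * 150 + 34)) => /=; [ |move=> h lth|lia].
  (* An empty list after [a < m - 2] removals means that the list had only [a] hyperedges. *)
  by move=> nH0; apply: abortOK; lia.
set p := regs st' "nH" in nH' okH' lth *.
set st1 := count_draw _.
apply: (@wp_seq _ _ _ _ _ 6 (m * 150 + 26) _
  (fun st'' => st'' = store st1 "nH" (p - 1))); last by lia.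
  exact: wp_run.
move=> _ _ ->; set st2 := store _ _ _.
pose H := arrs st' "H"; pose f c := H (h * m + c).
(* Row [h] is overwritten up to column [c] only, so both reads at column [c] still see the old
   contents, even when [h] is the last row. *)
pose J c st3 := indexed_bag (xs ++ mkseq f c) st3 /\
  forall k c', c' < m -> arrs st3 "H" (k * m + c') =
    if (k == h) && (c' < c) then H ((p - 1) * m + c') else H (k * m + c').
apply: (wp_conseq (T := m * 150 + 26) (Q := J m)) => //; last first.
  move=> st3 fr3 [B3 H3] /=.
  have nH3 : regs st3 "nH" = p - 1 by rewrite fr3.1.
  rewrite nH3; split; first by lia.
  exists (xs ++ mkseq f m); split=> //.
    by have [uh hv] := okH' h lth; apply: union_of_cat => //; rewrite size_mkseq.
  move=> k ltk; rewrite /hyperedge.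
  have -> : mkseq (fun c => arrs st3 "H" (k * m + c)) m =
      hyperedge st' m (if k == h then p - 1 else k).
    by apply: eq_in_mkseq => c ltc; rewrite H3 // ltc andbT; case: eqP.
  by apply: okH'; case: eqP => _; lia.
apply: (wp_for (n := m) (f := fun=> 120)) => //.
- by rewrite sum_nat_const card_ord /=; lia.
- by split=> [|k c' _]; rewrite ?cats0 ?ltn0 ?andbF.
- by move=> c st3 _ fr3 _ /=; rewrite fr3.1.
move=> c st3 ltc fr3 st3c [B3 H3].
have h3 : regs st3 "h" = h by rewrite fr3.1.
have m3 : regs st3 "m" = m by rewrite fr3.1.
have nH3 : regs st3 "nH" = p - 1 by rewrite fr3.1.
apply: (@wp_seq _ _ _ _ _ 15 100 _
  (fun st'' => st'' = store st3 "x" (f c))); last by lia.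
  by apply: wp_run => //=; rewrite h3 m3 st3c H3 // ltnn andbF.
move=> _ _ ->.
apply: (@wp_seq _ _ _ _ _ 60 35 _ (fun st4 => frame bag_add (store st3 "x" (f c)) st4
   /\ indexed_bag (xs ++ mkseq f c.+1) st4)); last by lia.
  apply: (wp_conseq (wp_bag_add w A (xs := xs ++ mkseq f c) _)) => //.
  by move=> st4 fr4; rewrite rcons_cat -mkseqS.
move=> st4 _ [fr4 B4]; apply: wp_run => //.
have H4 : arrs st4 "H" = arrs st3 "H" by rewrite fr4.2.
split=> //= k c' ltc'.
rewrite H4 !fr4.1 //= h3 m3 nH3 st3c cell_inj //.
rewrite !H3 // ltnn andbF ltnS [c' <= c]leq_eqVlt.
case: (k =P h) => [->|_] //=; case: (c' =P c) => [->|_] //=.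
Qed.

End RoundLoops.

(** * Invariance under a round *)

Lemma count_mkseq_const (x y n : nat) :
  count_mem x (mkseq (fun=> y) n) = (y == x) * n.
Proof.
by elim: n => [|n IH]; rewrite ?muln0 // mkseqS -cats1 count_cat IH /= addn0 mulnS addnC.
Qed.

(** With the smaller endpoint first, this expresses simplicity: increasing pairs exclude loops, and
    [uniq] excludes multiple edges. *)
Definition edges_ok (v : nat) (s : seq (nat * nat)) : Prop :=
  uniq s /\ forall p, p \in s -> p.1 < p.2 < v.

Lemma edges_ok_add v s us :
  edges_ok v s -> uniq us -> {subset us <= gtn v} ->
  edges_ok v.+1 (s ++ [seq (u, v) | u <- us]).
Proof.
move=> [us0 lts] uus usv; split.
  rewrite cat_uniq us0 map_inj_uniq ?uus ?andbT /=; last by move=> ? ? [].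
  by apply/hasPn => _ /mapP[u _ ->]; apply/negP => /lts /=; rewrite ltnn andbF.
move=> p; rewrite mem_cat => /orP[/lts|/mapP[u /usv ltu ->]] /=; first by lia.
by rewrite -[u < v]/(u \in gtn v) ltu ltnS leqnn.
Qed.

Section Rounds.
Variables (w : tape) (A : Prop).
Local Notation wp := (wp w A).

(** The last clause makes [A] the only excuse for a list too short to draw from. *)
Definition round_inv (n m z v : nat) (st : state) : Prop :=
  [/\ stores_params n m z st, regs st "nV" = v, edges_ok v (edge_list st),
      hyperedges_ok v m (regs st "nH") st
    & regs st "nH" < maxn 1 (m - 2) -> A].

Lemma wp_SEC_round n m z v st :
  2 <= m -> 0 < z -> round_inv n m z v st ->
  wp SEC_round st (1200 * (m * z + m ^ 2)) (round_inv n m z v.+1).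
Proof.
move=> m2 z0 [[eqn eqm eqz] eqnV okE okH abortOK]; set nH := regs st "nH" in okH abortOK.
(* Naming [M] and [Z] makes the time budget linear; lower-order terms are absorbed by [M] through
   [m + 1 <= M], which uses [2 <= m]. *)
pose M := m * m.
have leM : m + 1 <= M by rewrite /M; nia.
have leM2 : (m - 2) * (m * 150 + 60) <= M * 150 by rewrite /M; nia.
rewrite -[m ^ 2]/M; pose Z := m * z; rewrite -/Z.
have leZ : m <= Z by rewrite /Z; nia.
have leZz : z <= Z by rewrite /Z; nia.
apply: (@wp_seq _ _ _ _ _ 3 (270 * Z + 1100 * M) _
  (fun st' => st' = store st "N" 0)); last by lia.
  exact: wp_run.
move=> _ _ ->; set st1 := store _ _ _.
apply: (@wp_seq _ _ sample_hyperedges _ _ (z * (m * 100 + 50) + 20)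
  (121 * Z + 1070 * M) _
  (fun st' => exists2 xs, indexed_bag xs st' & union_of v m z xs)); last 1 first.
- by rewrite /Z in leZ leZz *; nia.
- apply: (wp_sample_hyperedges _ (v := v) (nH := nH)) => //.
  by move=> nH0; apply: abortOK; rewrite nH0; lia.
move=> st2 fr2 [xs [B2 N2 _] [szxs cntxs xsv]].
have m2' : regs st2 "m" = m by rewrite fr2.1.
have z2 : regs st2 "z" = z by rewrite fr2.1.
apply: (@wp_seq _ _ _ _ _ 6 (121 * Z + 1060 * M) _
  (fun st' => st' = store st2 "s" (z * m))); last by lia.
  by apply: wp_run => //=; rewrite m2' z2.
move=> _ _ ->; set st3 := store _ _ _.
apply: (wp_seq (T2 := 950 * M) (T1 := regs st2 "N" * 120 + 100)
  (wp_RSS w A (xs := xs) (z := z) (m := m) (st := st3) _ _ _ _ _ _ _)) => //; [by lia | |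
  by move: N2; rewrite szxs /Z; lia].
move=> st4 fr4 [uniqU subU].
set us := mkseq (arrs st4 "U") m in uniqU subU.
have usv : {subset us <= gtn v} by move=> x /subU /xsv.
apply: (@wp_seq _ _ _ _ _ 3 (940 * M) _ (fun st' => st' = store st4 "v" v)); last by lia.
  by apply: wp_run => //=; rewrite fr4.1 // /st3 /= fr2.1 // /st1 /= eqnV.
move=> _ _ ->.
apply: (@wp_seq _ _ _ _ _ 5 (930 * M) _
  (fun st' => st' = store (store st4 "v" v) "nV" v.+1)); last by lia.
  by apply: wp_run => //=; rewrite fr4.1 // /st3 /= fr2.1 // /st1 /= eqnV addn1.
move=> _ _ ->; set st5 := store _ _ _.
have m5 : regs st5 "m" = m by rewrite /st5 /= fr4.1.
apply: (wp_seq (T2 := 850 * M) (wp_add_edges w A (m := m) (v := v) (st := st5) _ _)) => //;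
  last by lia.
move=> st6 fr6 edges6.
have {edges6} okE6 : edges_ok v.+1 (edge_list st6).
  rewrite edges6.
  have -> : edge_list st5 = edge_list st.
    by rewrite /edge_list /st5 /= fr4.1 // !fr4.2 // /st3 /= fr2.1 // !fr2.2.
  have -> : mkseq (fun c => (arrs st5 "U" c, v)) m = [seq (u, v) | u <- us].
    by rewrite -map_comp.
  exact: edges_ok_add.
have nH6 : regs st6 "nH" = nH by rewrite fr6.1 // /st5 /= fr4.1 // /st3 /= fr2.1.
have H6 : arrs st6 "H" = arrs st "H" by rewrite fr6.2 // /st5 /= fr4.2 // /st3 /= fr2.2.
have U6 : arrs st6 "U" = arrs st4 "U" by rewrite fr6.2.
have v6 : regs st6 "v" = v by rewrite fr6.1.
have nV6 : regs st6 "nV" = v.+1 by rewrite fr6.1.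
have m6 : regs st6 "m" = m by rewrite fr6.1.
have n6 : regs st6 "n" = n by rewrite fr6.1 // /st5 /= fr4.1 // /st3 /= fr2.1.
have z6 : regs st6 "z" = z by rewrite fr6.1 // /st5 /= fr4.1.
apply: (@wp_seq _ _ _ _ _ 3 (840 * M) _ (fun st' => st' = store st6 "N" 0)); last by lia.
  exact: wp_run.
move=> _ _ ->; set st7 := store _ _ _.
apply: (wp_seq (T2 := 680 * M) (T1 := (m - 2) * (m * 150 + 60) + 20)
  (wp_remove_hyperedges w (A := A) (v := v) (m := m) (nH := nH) (st := st7) _ _ _ _ _)) => //; last by lia.
- by move=> lt; apply: abortOK; lia.
- by move=> k ltk; rewrite /hyperedge /= H6; apply: okH.
move=> st8 fr8 [nH8 [ys [B8 [szys cntys ysv] okH8]]].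
have m8 : regs st8 "m" = m by rewrite fr8.1.
have v8 : regs st8 "v" = v by rewrite fr8.1.
apply: (wp_seq (T2 := 570 * M) (wp_add_all w A (e := "v"%string) (f := fun=> v)
  (m := m) (xs := ys) (st := st8) _ _ _ _)) => //; last by lia.
  by move=> c st' _ fr _ /=; rewrite fr.1.
move=> st9 fr9 B9.
have m9 : regs st9 "m" = m by rewrite fr9.1.
apply: (wp_seq (T2 := 460 * M) (wp_add_all w A (e := ("U".["c"])%exp)
  (f := arrs st4 "U") (m := m) (xs := ys ++ mkseq (fun=> v) m) (st := st9) _ _ _ _)) => //;
  last by lia.
  by move=> c st' _ fr st'c /=; rewrite st'c fr.2 // fr9.2 // fr8.2 // U6.
move=> st10 fr10 [B10 N10 _].
set zs := (_ ++ _) in B10 N10.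
have m10 : regs st10 "m" = m by rewrite fr10.1.
(* Here [2 <= m] matters: the truncated [m - 2] is exact, and [(m - 2) * m + m + m] is [m * m]. *)
have szzs : size zs = m * m by rewrite /zs !size_cat szys !size_mkseq; nia.
have vys : v \notin ys by apply/negP => /ysv; rewrite /in_mem /= ltnn.
have vus : v \notin us by apply/negP => /usv; rewrite /in_mem /= ltnn.
(* The new vertex occurs only as its [m] copies; any other vertex occurs at most [m - 2] times in
   [ys] and once in the sample. *)
have cntzs x : count_mem x zs <= m.
  rewrite /zs !count_cat count_mkseq_const (count_uniq_mem x uniqU).
  case: (v =P x) => [<-|_]; first by rewrite (count_memPn vys) (negPf vus); lia.
  by have := cntys x; case: (x \in us); lia.
have zsv : {subset zs <= gtn v.+1}.
  move=> x; rewrite !mem_cat -/us => /orP[/orP[/ysv|/mem_mkseq_nat[_ _ ->]]|/usv];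
    rewrite /in_mem /=; lia.
apply: (@wp_seq _ _ _ _ _ 3 (450 * M) _
  (fun st' => st' = store st10 "s" m)); last by lia.
  by apply: wp_run => //=; rewrite m10.
move=> _ _ ->; set st11 := store _ _ _.
apply: (wp_conseq (wp_RSP w A (xs := zs) (s := m) (m := m) (st := st11) _ _ _ _ _)) => //.
  by rewrite /= /M; move: N10; rewrite szzs; lia.
move=> st12 fr12 [nH12 old new].
have nH11 : regs st11 "nH" = regs st8 "nH" by rewrite /= fr10.1 // fr9.1.
split.
- by split; rewrite fr12.1 //= fr10.1 // fr9.1 // fr8.1.
- by rewrite fr12.1 //= fr10.1 // fr9.1 // fr8.1.
- rewrite /edge_list fr12.1 // !fr12.2 //= fr10.1 // !fr10.2 // fr9.1 // !fr9.2 //.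
  by rewrite fr8.1 // !fr8.2.
- rewrite nH12 nH11 => k ltk; case: (ltnP k (regs st8 "nH")) => [ltk8|lek8].
    rewrite old ?nH11 // /hyperedge /= fr10.2 // fr9.2 //.
    have [uk kv] := okH8 k ltk8; split=> // x /kv.
    by rewrite /in_mem /=; lia.
  have [|uk kv] := new k; first by rewrite nH11 lek8.
  by split=> // x /kv /zsv.
(* The round removes [m - 2] hyperedges and adds [m], so a short list now was a short list
   before. *)
- by rewrite nH12 nH11 => lt; apply: abortOK; lia.
Qed.

Lemma wp_SEC_loop n m z v st :
  2 <= m -> 0 < z -> v <= n -> round_inv n m z v st ->
  wp SEC_loop st (n * (1200 * (m * z + m ^ 2) + 6) + 6) (round_inv n m z n).
Proof.
move=> m2 z0 levn inv0.
(* The index [k] is the number of vertices still missing; there are [n - v] rounds. *)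
pose I k st' := k <= n /\ round_inv n m z (n - k) st'.
have Q : wp SEC_loop st (\sum_(k < n - v) 1200 * (m * z + m ^ 2) +
   (n - v) * 4 + 4) (I 0).
  apply: (wp_while (I := I) (f := fun=> 1200 * (m * z + m ^ 2))).
  - by split; rewrite ?leq_subr ?subKn.
  - move=> k st' [lek [[eqn _ _] eqnV _ _ _]] /=; rewrite eqn eqnV; lia.
  move=> k st' [ltk inv]; apply: (wp_conseq (wp_SEC_round m2 z0 inv)) => // st'' _.
  by split; [lia|have -> : n - k = (n - k.+1).+1 by lia].
apply: (wp_conseq Q) => [|st' _ [_]]; last by rewrite subn0.
rewrite sum_nat_const card_ord; nia.
Qed.

End Rounds.

(** * Initial hyperedges from the degrees *)

Definition edge_endpoints (st : state) (k : nat) : seq nat :=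
  mkseq (arrs st "E1") k ++ mkseq (arrs st "E2") k.

Lemma count_edge_endpointsS st k x :
  count_mem x (edge_endpoints st k.+1) =
  count_mem x (edge_endpoints st k) + (x == arrs st "E1" k) + (x == arrs st "E2" k).
Proof.
have count1 y : count_mem x [:: y] = (x == y) by rewrite /= addn0 eq_sym.
by rewrite /edge_endpoints !mkseqS -!cats1 !count_cat !count1; lia.
Qed.

Section Initialization.
Variables (w : tape) (A : Prop).
Local Notation wp := (wp w A).

(** The bag of all edge endpoints has the degrees as frequencies: its size is [2 * nE = s * m] and
    no frequency exceeds [s], as the partitioning requires. Vertices serve as their own indices in
    [X], so [pos] is avoided. *)
Lemma wp_SEC_init m v nE s st :
  regs st "m" = m -> regs st "nV" = v -> regs st "nE" = nE -> 0 < m ->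
  2 * nE = s * m -> edges_ok v (edge_list st) ->
  (forall x, count_mem x (edge_endpoints st nE) <= s) ->
  wp SEC_init st (v * 200 + nE * 100 + (s + s * m) * 120 + 300)
    (fun st' => regs st' "nH" = s /\ hyperedges_ok v m s st').
Proof.
move=> eqm eqnV eqnE m0 hsk [_ okE] cnts.
have endp i : i < nE -> arrs st "E1" i < v /\ arrs st "E2" i < v.
  move=> lti; have /okE /= : (arrs st "E1" i, arrs st "E2" i) \in edge_list st.
    by apply: map_f; rewrite mem_iota eqnE.
  by move=> /andP[lt1 lt2]; split=> //; apply: ltn_trans lt2.
apply: (@wp_seq _ _ _ _ _ (v * 30 + 20)
  (v * 150 + nE * 100 + (s + s * m) * 120 + 270) _
  (fun st' => forall j, j < v -> arrs st' "X" j = j /\ arrs st' "F" j = 0));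
  last by lia.
  apply: (wp_for (n := v) (f := fun=> 15)
    (I := fun i st' => forall j, j < i -> arrs st' "X" j = j /\ arrs st' "F" j = 0)) => //.
  - by rewrite sum_nat_const card_ord /=; lia.
  - by move=> i st' _ fr _ /=; rewrite fr.1.
  move=> i st' lti fr st'i XF; apply: wp_run => //= j ltj /=; rewrite st'i.
  by case: (j =P i) => [->//|nji]; apply: XF; lia.
move=> st1 fr1 XF1.
apply: (@wp_seq _ _ _ _ _ 3 (v * 150 + nE * 100 + (s + s * m) * 120 + 260) _
  (fun st' => st' = store st1 "N" v)); last by lia.
  by apply: wp_run => //=; rewrite fr1.1 // eqnV.
move=> _ _ ->; set st2 := store _ _ _.
pose D i st' := forall j, j < v -> arrs st' "F" j = count_mem j (edge_endpoints st i).
apply: (@wp_seq _ _ _ _ _ (nE * 100 + 20) (v * 150 + (s + s * m) * 120 + 230) _ (D nE));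
  last by lia.
  apply: (wp_for (n := nE) (f := fun=> 80)) => //.
  - by rewrite sum_nat_const card_ord /=; lia.
  - by move=> j /XF1[_].
  - by move=> i st' _ fr _ /=; rewrite fr.1 //= fr1.1.
  move=> i st' lti fr st'i Di; apply: wp_run => // j ltj.
  have E1i : arrs st' "E1" i = arrs st "E1" i by rewrite fr.2 //= fr1.2.
  have E2i : arrs st' "E2" i = arrs st "E2" i by rewrite fr.2 //= fr1.2.
  rewrite count_edge_endpointsS /= st'i E1i E2i.
  have [lt1 lt2] := endp i lti.
  rewrite !Di //.
  by case: (j =P _) => [<-|_]; case: (j =P _) => [<-|_]; rewrite ?addn0.
move=> st3 fr3 D3.
apply: (@wp_seq _ _ _ _ _ 3 (v * 150 + (s + s * m) * 120 + 220) _
  (fun st' => st' = store st3 "nH" 0)); last by lia.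
  exact: wp_run.
move=> _ _ ->.
apply: (@wp_seq _ _ _ _ _ 10 (v * 150 + (s + s * m) * 120 + 200) _
  (fun st' => st' = store (store st3 "nH" 0) "s" s)); last by lia.
  apply: wp_run => //=.
  by rewrite !fr3.1 //= !fr1.1 // eqnE eqm hsk mulnK.
move=> _ _ ->; set st4 := store _ _ _.
have N4 : regs st4 "N" = v by rewrite /= fr3.1.
have X4 : mkseq (arrs st4 "X") v = iota 0 v.
  rewrite -[RHS]map_id; apply: eq_in_mkseq => j ltj.
  by rewrite /= fr3.2 //; case: (XF1 j ltj).
have B4 : bag (edge_endpoints st nE) st4.
  rewrite /bag N4 X4; split.
  - exact: iota_uniq.
  - move=> x; rewrite mem_cat mem_iota.
    by case/orP => /mem_mkseq_nat[i /endp[lt1 lt2] ->].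
  - move=> i lti; have := nth_iota 0 0 lti; rewrite -X4 nth_mkseq // add0n => Xi.
    by rewrite Xi D3.
apply: (wp_conseq (wp_RSP w A (s := s) (m := m) B4 _ _ _ _)) => //.
- by rewrite /= fr3.1 //= fr1.1.
- by rewrite size_cat !size_mkseq -hsk; lia.
- by rewrite N4; lia.
move=> st5 _ [nH5 _ new]; split; first exact: nH5.
move=> k ltk; have [//|uk kv] := new k; split=> // x /kv.
by rewrite mem_cat => /orP[] /mem_mkseq_nat[i /endp[lt1 lt2] ->].
Qed.

End Initialization.

(** * Edge lists and simple graphs *)

Section Graph.
Variables (v : nat) (e : rel 'I_v).

Lemma count_edges (P : pred ('I_v * 'I_v)) :
  count P (enum (edges e)) =
  \sum_(x : 'I_v) \sum_(y : 'I_v) ((x < y) && e x y && P (x, y)).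
Proof.
rewrite -sum1_count big_enum_cond big_mkcond pair_bigA /=.
by apply: eq_bigr => -[x y] _; rewrite inE /=; case: (_ && _); case: (P _).
Qed.

(** By symmetry each neighbour [y] of [x] is counted once, in the first term if [x < y] and in the
    second if [y < x]; irreflexivity excludes [y = x]. *)
Lemma degree_sum (x : 'I_v) : simple_graph e ->
  count (fun p : 'I_v * 'I_v => p.1 == x) (enum (edges e)) +
  count (fun p : 'I_v * 'I_v => p.2 == x) (enum (edges e)) = degree e x.
Proof.
move=> [sym irr]; rewrite !count_edges /= (bigD1 x) //= addnC.
rewrite [X in _ + (_ + X)]big1 ?addn0; last first.
  by move=> y neq; rewrite big1 // => z _; rewrite (negPf neq) andbF.
rewrite (eq_bigr (fun y : 'I_v => ((y < x) && e y x) : nat)); last first.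
  move=> y _; rewrite (bigD1 x) //= eqxx andbT big1 ?addn0 // => z neq.
  by rewrite (negPf neq) andbF.
rewrite -big_split /= /degree -sum1dep_card [RHS]big_mkcond /=.
apply: eq_bigr => y _; rewrite eqxx andbT [e y x]sym.
case: (ltngtP x y) => [lt|lt|/val_inj->]; rewrite ?irr //=; by case: (e x y).
Qed.

Lemma stores_graph_edges_ok st : stores_graph e st -> edges_ok v (edge_list st).
Proof.
case=> _ eqnE perm; rewrite /edges_ok /edge_list eqnE; split.
  rewrite (perm_uniq perm) map_inj_uniq ?enum_uniq //.
  by move=> [x1 x2] [y1 y2] /= [/val_inj-> /val_inj->].
move=> p; rewrite (perm_mem perm) => /mapP[[x y]].
by rewrite mem_enum inE /= => /andP[ltxy _] -> /=; rewrite ltxy /=.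
Qed.

Lemma count_edge_endpoints st s :
  simple_graph e -> stores_graph e st -> (forall x, degree e x <= s) ->
  forall x, count_mem x (edge_endpoints st #|edges e|) <= s.
Proof.
move=> simple [_ _ perm] degs x.
have -> : count_mem x (edge_endpoints st #|edges e|) =
    count (fun p : 'I_v * 'I_v => val p.1 == x) (enum (edges e)) +
    count (fun p : 'I_v * 'I_v => val p.2 == x) (enum (edges e)).
  have := permP (perm_map fst perm) (pred1 x).
  have := permP (perm_map snd perm) (pred1 x).
  by rewrite /edge_endpoints count_cat -!map_comp !count_map => <- <-.
have [ltx|lex] := ltnP x v.
  exact: leq_trans (eq_leq (degree_sum (Ordinal ltx) simple)) (degs _).
(* A number that is not a vertex is no endpoint. *)
rewrite !(eq_count (a2 := pred0)) ?count_pred0 // => -[[y1 lt1] [y2 lt2]] /=;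
  by apply/eqP => ?; lia.
Qed.

End Graph.

(** The graph is the symmetrized membership relation of the stored list; the ordering of pairs
    recovers that list from it up to permutation. *)
Lemma edges_ok_creates n st :
  regs st "nV" = n -> edges_ok n (edge_list st) -> creates_graph n (Some st).
Proof.
move=> eqnV [uel lts]; set el := edge_list st in uel lts.
pose e (x y : 'I_n) := ((val x, val y) \in el) || ((val y, val x) \in el).
have perm : perm_eq el [seq (val p.1, val p.2) | p <- enum (edges e)].
  apply: uniq_perm => //.
    rewrite map_inj_uniq ?enum_uniq //.
    by move=> [x1 x2] [y1 y2] /= [/val_inj-> /val_inj->].
  move=> [x y]; apply/idP/mapP => [xyel|[[x' y']]].
    have /andP[ltxy lty] := lts _ xyel; have ltx := ltn_trans ltxy lty.
    exists (Ordinal ltx, Ordinal lty) => //.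
    by rewrite mem_enum inE /= [_ < _]ltxy /e /= xyel.
  rewrite mem_enum inE /= => /andP[ltxy /orP[|]] xyel [-> ->] //.
  by have := lts _ xyel => /=; lia.
have eqnE : regs st "nE" = #|edges e|.
  by have := perm_size perm; rewrite size_mkseq size_map -cardE.
exists st, e; split=> //.
  split=> [x y|x]; first by rewrite /e orbC.
  by apply/norP; split; apply/negP => /lts; rewrite /= ltnn.
by split=> //; rewrite -eqnE.
Qed.

Theorem theorem23 :
  exists C : nat,
  forall (m z n v0 : nat) (e0 : rel 'I_v0) (w : tape),
    2 <= m -> 1 <= z -> v0 <= n -> initial_graph e0 m ->
    (forall (H0 : seq {set 'I_v0}) (st : state),
       initial_hyperedges e0 m H0 ->
       stores_params n m z st -> stores_graph e0 st ->
       stores_hyperedges m H0 st ->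
       exists (t : nat) (o : option state),
         [/\ exec w SEC_loop st t o,
             t <= C * (n * m * z + n * m ^ 2)
           & enough_hyperedges e0 m -> creates_graph n o]) /\
    (forall st : state,
       #|edges e0| <= n * m ->
       stores_params n m z st -> stores_graph e0 st ->
       exists (t : nat) (o : option state),
         [/\ exec w SEC st t o,
             t <= C * (n * m * z + n * m ^ 2)
           & enough_hyperedges e0 m -> creates_graph n o]).
Proof.
(* An abstract [C] keeps the large numeral out of computations. The rounds take 1200 of the 3000;
   the remainder absorbs initialization and constants. *)
have [C leC] : exists C, 3000 <= C by exists 3000.
exists C => m z n v0 e0 w m2 z0 lev [simple [v00 _] dvd degs].
have n0 : 0 < n by lia.
set s := 2 * #|edges e0| %/ m in degs.
have hsk : 2 * #|edges e0| = s * m by rewrite /s divnK.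
(* With this choice an abort contradicts the premise under which a graph is promised. *)
pose A := ~ enough_hyperedges e0 m.
have abortA nH : nH = s -> nH < maxn 1 (m - 2) -> A.
  by move=> -> lt; rewrite /A /enough_hyperedges -/s; lia.
have finish c st T : T <= 3000 * (n * m * z + n * m ^ 2) ->
    wp w A c st T (round_inv A n m z n) ->
    exists t o, [/\ exec w c st t o, t <= C * (n * m * z + n * m ^ 2)
      & enough_hyperedges e0 m -> creates_graph n o].
  move=> leT [t [o [ex tT Qo]]]; exists t, o; split=> //.
    by apply: leq_trans tT (leq_trans leT _); rewrite leq_mul2r leC orbT.
  case: o Qo {ex} => [st'|nenough] // [_ eqnV okE _ _] _.
  exact: edges_ok_creates.
have nm1 : n <= n * m * z by rewrite -mulnA leq_pmulr // muln_gt0; lia.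
have nm2 : n * m <= n * m * z by rewrite leq_pmulr.
have loop_cost : n * (1200 * (m * z + m ^ 2) + 6) + 6 =
    1200 * (n * m * z + n * m ^ 2) + 6 * n + 6.
  have -> : n * m * z + n * m ^ 2 = n * (m * z + m ^ 2) by rewrite mulnDr mulnA.
  by move: (m * z + m ^ 2) => Y; lia.
split=> [H0 st [szH uH _] params graph [eqnH hyps]|st leE params graph].
  apply: (finish _ _ (n * (1200 * (m * z + m ^ 2) + 6) + 6)); first by lia.
  apply: (@wp_SEC_loop _ _ _ _ _ v0) => //; split=> //.
  - by case: graph.
  - exact: stores_graph_edges_ok graph.
  - rewrite eqnH => k ltk; have perm := hyps k ltk.
    rewrite /hyperedge; split.
      by rewrite (perm_uniq perm) map_inj_uniq ?enum_uniq //; apply: val_inj.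
    by move=> x; rewrite (perm_mem perm) => /mapP[y _ ->]; apply: (ltn_ord y).
  - by apply: abortA; rewrite eqnH.
case: (params) (graph) => eqn eqm eqz [eqnV eqnE _].
have okE := stores_graph_edges_ok graph.
(* The bound [n * m] on the number of edges enters here and makes the partitioning of the degrees
   cost [O(n * m)]. *)
have les : s <= 2 * n.
  have : s * m <= 2 * n * m by rewrite -hsk; lia.
  by rewrite leq_pmul2r; lia.
apply: (finish _ _ ((v0 * 200 + #|edges e0| * 100 + (s + s * m) * 120 + 300) +
  (n * (1200 * (m * z + m ^ 2) + 6) + 6)).+1); first by rewrite -hsk; lia.
apply: (wp_seq (wp_SEC_init w A eqm eqnV eqnE _ hsk okE _)) => //.
- lia.
- exact: count_edge_endpoints.
move=> st1 fr1 [nH1 ok1]; apply: (@wp_SEC_loop _ _ _ _ _ v0) => //; split.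
- by split; rewrite fr1.1.
- by rewrite fr1.1.
- by rewrite /edge_list fr1.1 // !fr1.2.
- by rewrite nH1.
- exact: abortA.
Qed.
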